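(* If a vertex-transitive graph $\Gamma$ has an efficient dominating set, then $\gamma_{\mathrm{all}}^\infty(\Gamma)=\gamma(\Gamma)$.
   Context: Graphs are finite, undirected and simple. A vertex $u$ dominates a vertex $w$ if $w=u$ or $w$ is adjacent to $u$. A dominating set is a set $D$ of vertices such that every vertex is dominated by at least one vertex of $D$; $\gamma(\Gamma)$ is the smallest size of a dominating set of $\Gamma$. An efficient dominating set (perfect code) is a set $D$ of vertices such that every vertex of the graph is dominated by exactly one vertex of $D$. Guards located at the vertices of a set $D$ (one guard per vertex) can reconfigure to a set $D'$ if there is a bijection $f:D\to D'$ such that for every $d\in D$, either $f(d)=d$ or $f(d)$ is adjacent to $d$. An eternal dominating configuration for $\Gamma$ is a nonempty collection $\mathcal D$ of subsets of $V(\Gamma)$, all of the same cardinality, such that for every $D_i\in\mathcal D$ and every vertex $w\notin D_i$ there is $D_j\in\mathcal D$ with $w\in D_j$ such that guards at $D_i$ can reconfigure to $D_j$. An eternal dominating set is a member of some eternal dominating configuration. The eternal domination number $\gamma_{\mathrm{all}}^\infty(\Gamma)$ is the smallest cardinality of an eternal dominating set. *)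

(* Defs.v *)
From mathcomp Require Import all_boot all_fingroup.

Set Implicit Arguments.
Unset Strict Implicit.
Unset Printing Implicit Defensive.

(* A finite simple graph is a symmetric irreflexive adjacency relation [e] on  *)
(* a finite type [T]; symmetry and irreflexivity are hypotheses of the theorem.*)
Section GraphDomination.

Variables (T : finType) (e : rel T).
Implicit Types (u v w : T) (D : {set T}) (C : {set {set T}}).

Definition automorphism (g : {perm T}) : Prop :=
  forall x y, e (g x) (g y) = e x y.

Definition vertex_transitive : Prop :=
  forall u v, exists2 g : {perm T}, automorphism g & g u = v.

Definition dominates u w : bool := (w == u) || e u w.

Definition dominating D : bool := [forall w, exists u in D, dominates u w].

Definition efficient_dominating D : bool :=
  [forall w, #|[set u in D | dominates u w]| == 1].

(* A bijection D -> D' is given by a function on T, of which only the values   *)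
(* on D matter, that is injective on D with image D'.                          *)
Definition reconfigures D D' : bool :=
  [exists f : {ffun T -> T},
    [&& dinjectiveb f (mem D), f @: D == D' &
        [forall d in D, (f d == d) || e d (f d)]]].

Definition eternal_config C : bool :=
  [&& C != set0,
      [forall D1 in C, forall D2 in C, #|D1| == #|D2|] &
      [forall D in C, forall w, (w \notin D) ==>
         [exists D' in C, (w \in D') && reconfigures D D']]].

Definition eternal_dominating D : bool :=
  [exists C, eternal_config C && (D \in C)].

(* The starting point [setT] of the two minimizations below always satisfies   *)
(* the constraint, so both are genuine minima.                                 *)
Lemma dominating_setT : dominating setT.
Proof.
by apply/forallP => w; apply/existsP; exists w; rewrite inE /dominates eqxx.
Qed.

Lemma eternal_dominating_setT : eternal_dominating setT.
Proof.
apply/existsP; exists [set setT]; rewrite inE eqxx andbT.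
apply/and3P; split.
- by apply/set0Pn; exists setT; rewrite inE.
- apply/forall_inP => D1 /set1P ->; apply/forall_inP => D2 /set1P ->.
  exact: eqxx.
- by apply/forall_inP => D /set1P ->; apply/forallP => w; rewrite inE.
Qed.

Definition domination_number : nat :=
  #|[arg min_(D < setT | dominating D) #|D|]|.

Definition eternal_domination_number : nat :=
  #|[arg min_(D < setT | eternal_dominating D) #|D|]|.

End GraphDomination.

(* Main.v *)
Require Import Defs.
From mathcomp Require Import all_boot all_fingroup.

(** Any two efficient dominating sets D and D' can be reconfigured into one
    another: send each d in D to the unique vertex of D' dominating it; since
    domination is a symmetric relation, the same map from D' to D is its
    inverse. By vertex-transitivity every vertex lies in some efficient
    dominating set, so the efficient dominating sets form an eternal dominating
    configuration. Their size is minimal among dominating sets: a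
    vertex-transitive graph is regular, of degree k say, so that
    #|E| (k + 1) >= #|V| for every dominating set E, with equality when E is
    efficient. *)

Section Domination.

Set Implicit Arguments.
Unset Strict Implicit.

Variables (T : finType) (e : rel T).

Lemma dominates_sym : symmetric e -> symmetric (dominates e).
Proof. by move=> e_sym u w; rewrite /dominates eq_sym e_sym. Qed.

Lemma automorphism_dominates (g : {perm T}) :
  automorphism e g -> forall u w, dominates e (g u) (g w) = dominates e u w.
Proof. by move=> g_aut u w; rewrite /dominates (inj_eq perm_inj) g_aut. Qed.

(** Existence and uniqueness in one boolean equation: at [v := u] it yields the dominator, and
    rewritten from right to left it identifies any other dominator with [u]. *)
Lemma efficient_dominatingP (D : {set T}) (w : T) :
  efficient_dominating e D ->
  exists u, forall v, (v \in D) && dominates e v w = (v == u).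
Proof.
move=> /forallP/(_ w)/cards1P[u /setP Du]; exists u => v.
by move: (Du v); rewrite !inE.
Qed.

Lemma efficient_dominating_imset (g : {perm T}) (D : {set T}) :
  automorphism e g -> efficient_dominating e D ->
  efficient_dominating e (g @: D).
Proof.
(* [g] maps the dominators of [g^-1 w] in [D] bijectively onto those of [w] in [g @: D]. *)
move=> g_aut /forallP D_eff; apply/forallP => w.
rewrite -(eqP (D_eff ((g^-1)%g w))) -[eqbRHS](card_imset _ (@perm_inj _ g)).
apply/eqP/eq_card => v; rewrite inE -[v](permKV g) !(mem_imset _ _ perm_inj).
by rewrite inE -(automorphism_dominates g_aut _ (g^-1%g w)) !permKV.
Qed.

Lemma efficient_reconfigures (D D' : {set T}) :
  symmetric e -> efficient_dominating e D -> efficient_dominating e D' ->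
  reconfigures e D D'.
Proof.
move=> e_sym D_eff D'_eff; have dom_sym := dominates_sym e_sym.
(* The default [d] is never taken: [fP] shows that the pick always succeeds. *)
pose f := [ffun d => odflt d [pick v in D' | dominates e v d]].
have fP d : (f d \in D') && dominates e (f d) d.
  have [u Du] := efficient_dominatingP d D'_eff.
  by rewrite ffunE; case: pickP => //= /(_ u); rewrite Du eqxx.
apply/existsP; exists f; apply/and3P; split.
- apply/dinjectiveP => d1 d2 D1 D2 f12.
  (* By symmetry [d1] and [d2] both dominate [f d1], which has only one dominator in [D]. *)
  have [u Du] := efficient_dominatingP (f d1) D_eff.
  have /andP[_ dom1] := fP d1; have /andP[_ dom2] := fP d2.
  have /eqP-> : d1 == u by rewrite -Du D1 dom_sym.
  by apply/esym/eqP; rewrite -Du D2 dom_sym f12.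
- apply/eqP/setP => v; apply/imsetP/idP => [[d _ ->]|D'v].
    by case/andP: (fP d).
  (* The preimage of [v] is its dominator [d] in [D]: both [v] and [f d] dominate [d] from [D'], so
     they coincide. *)
  have [d /(_ d)] := efficient_dominatingP v D_eff.
  rewrite eqxx => /andP[Dd dom_dv]; exists d => //.
  have [u Du] := efficient_dominatingP d D'_eff.
  have /eqP-> : v == u by rewrite -Du D'v dom_sym.
  by apply/esym/eqP; rewrite -Du.
- apply/forall_inP => d _; have /andP[_] := fP d.
  by rewrite dom_sym.
Qed.

Lemma reconfigures_card (D D' : {set T}) : reconfigures e D D' -> #|D| = #|D'|.
Proof.
by case/existsP => f /and3P[/dinjectiveP f_inj /eqP <- _]; rewrite card_in_imset.
Qed.

Lemma efficient_eternal_dominating (D : {set T}) :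
  symmetric e -> vertex_transitive e -> efficient_dominating e D ->
  eternal_dominating e D.
Proof.
move=> e_sym e_trans D_eff; apply/existsP.
exists [set D' | efficient_dominating e D']; rewrite inE D_eff andbT.
apply/and3P; split.
- by apply/set0Pn; exists D; rewrite inE.
- apply/forall_inP => D1; rewrite inE => D1_eff.
  apply/forall_inP => D2; rewrite inE => D2_eff.
  exact/eqP/reconfigures_card/efficient_reconfigures.
- apply/forall_inP => D1; rewrite inE => D1_eff.
  apply/forallP => w; apply/implyP => _.
  (* Here [u] only serves as some vertex of [D1]; an automorphism taking it to [w] carries [D1] to
     an efficient set through [w]. *)
  have [u /(_ u)] := efficient_dominatingP w D1_eff.
  rewrite eqxx => /andP[D1u _]; have [g g_aut guw] := e_trans u w.
  have gD1_eff := efficient_dominating_imset g_aut D1_eff.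
  apply/existsP; exists (g @: D1).
  by rewrite inE gD1_eff -{1}guw imset_f // efficient_reconfigures.
Qed.

Lemma eternal_dominating_dominating (D : {set T}) :
  eternal_dominating e D -> dominating e D.
Proof.
case/existsP => C /andP[/and3P[_ _ /forall_inP C_move] CD].
apply/forallP => w; have [Dw|D'w] := boolP (w \in D).
  by apply/existsP; exists w; rewrite Dw /dominates eqxx.
(* The guard that moves to [w] starts at a vertex dominating [w]. *)
have /forallP/(_ w)/implyP/(_ D'w)/existsP[D'] := C_move D CD.
case/and3P => _ wD' /existsP[f /and3P[_ /eqP fD /forall_inP f_move]].
move: wD'; rewrite -fD => /imsetP[d Dd ->].
by apply/existsP; exists d; rewrite Dd; apply: f_move.
Qed.

Lemma card_dominated (u v : T) :
  vertex_transitive e ->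
  #|[set w | dominates e u w]| = #|[set w | dominates e v w]|.
Proof.
move=> e_trans; have [g g_aut <-] := e_trans u v.
rewrite -(card_imset _ (@perm_inj _ g)); apply: eq_card => w.
by rewrite -[w](permKV g) (mem_imset _ _ perm_inj) !inE automorphism_dominates.
Qed.

(** Double counting of the pairs [(v, w)] with [v] in [D] dominating [w]; the reference vertex [u]
    supplies the common size of the closed neighbourhoods. *)
Lemma sum_card_dominators (u : T) (D : {set T}) :
  vertex_transitive e ->
  \sum_w #|[set v in D | dominates e v w]|
    = #|D| * #|[set w | dominates e u w]|.
Proof.
move=> e_trans; rewrite -sum_nat_const.
transitivity (\sum_w \sum_(v in D) (dominates e v w : nat)).
  apply: eq_bigr => w _; rewrite -sum1_card big_mkcond [RHS]big_mkcond /=.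
  by apply: eq_bigr => v _; rewrite inE; case: (v \in D) => //=; case: ifP.
rewrite exchange_big /=; apply: eq_bigr => v _.
rewrite -(card_dominated v) // -sum1_card [RHS]big_mkcond /=.
by apply: eq_bigr => w _; rewrite inE; case: ifP.
Qed.

Lemma efficient_dominating_min (D E : {set T}) :
  vertex_transitive e -> efficient_dominating e D -> dominating e E ->
  #|D| <= #|E|.
Proof.
move=> e_trans /forallP D_eff /forallP E_dom.
have [->|[u Du]] := set_0Vmem D; first by rewrite cards0.
have k_gt0 : 0 < #|[set w | dominates e u w]|.
  by apply/card_gt0P; exists u; rewrite inE /dominates eqxx.
(* The two sums compare termwise: each [w] has exactly one dominator in [D] and at least one in
   [E]. *)
rewrite -(leq_pmul2r k_gt0) -!sum_card_dominators //.
apply: leq_sum => w _; rewrite (eqP (D_eff w)); apply/card_gt0P.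
by have /existsP[v Ev] := E_dom w; exists v; rewrite inE.
Qed.

Lemma efficient_dominating_dominating (D : {set T}) :
  efficient_dominating e D -> dominating e D.
Proof.
move=> D_eff; apply/forallP => w.
have [u /(_ u)] := efficient_dominatingP w D_eff.
by rewrite eqxx => Du; apply/existsP; exists u.
Qed.

End Domination.

Theorem corollary2p2 (T : finType) (e : rel T)
    (e_sym : symmetric e) (e_irr : irreflexive e)
    (e_trans : vertex_transitive e)
    (e_eff : exists D : {set T}, efficient_dominating e D) :
  eternal_domination_number e = domination_number e.
Proof.
have [D D_eff] := e_eff.
rewrite /eternal_domination_number /domination_number.
case: arg_minnP => [|E E_et E_min]; first exact: eternal_dominating_setT.
case: arg_minnP => [|F F_dom F_min]; first exact: dominating_setT.
apply/eqP; rewrite eqn_leq F_min ?eternal_dominating_dominating // andbT.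
(* [D] lies between the two minima: [E] is no larger than [D], which is eternal dominating, and [D]
   is no larger than [F]. *)
apply: leq_trans (efficient_dominating_min e_trans D_eff F_dom).
exact/E_min/efficient_eternal_dominating.
Qed.
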